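(* Let $p$ be an odd prime. For $\lambda_1,\lambda_2\in\mathbb{F}_p$ let $F(\lambda_1,\lambda_2)=|\mathcal{X}_{\lambda_1,\lambda_2}|_p$ be the number of $\mathbb{F}_p$-rational points $(t,X,Y)$ of the affine model $$Y^2=X\,\bigl(X-t(t-1)(\lambda_2 t-\lambda_1)\bigr)\,\bigl(X-t(t-\lambda_1)(\lambda_2 t-1)\bigr)$$ of the Kummer surface $\mathcal{X}_{\lambda_1,\lambda_2}=\operatorname{Kum}(E_1\times E_2)$. Then the counting function $F$ satisfies the Picard-Fuchs system associated with the family $\mathcal{X}_{\lambda_1,\lambda_2}$ modulo $p$, that is, $$L_{\lambda_1}F\equiv 0 \quad\text{and}\quad L_{\lambda_2}F\equiv 0 \mod p .$$
   Context: $E_1,E_2$ are the elliptic curves with Legendre equations $y_k^2=x_k(x_k-1)(x_k-\lambda_k)$, $k=1,2$. $\operatorname{Kum}(E_1\times E_2)$ is the minimal resolution of the quotient of $E_1\times E_2$ by the inversion automorphism. Over $\mathbb{C}$, for non-isogenous $E_1,E_2$, the displayed affine equation is an affine model of $\operatorname{Kum}(E_1\times E_2)$ given by a Jacobian elliptic fibration with base coordinate $t$. The operator $L_z$ is the Gauss hypergeometric operator with parameters $\alpha=\beta=\tfrac12$, $\gamma=1$: $$L_z(F)=z(1-z)\frac{\partial^2F}{\partial z^2}+(1-2z)\frac{\partial F}{\partial z}-\frac14 F .$$ $L_{\lambda_i}$ denotes this operator in the variable $z=\lambda_i$. The Picard-Fuchs system of the family $\mathcal{X}_{\lambda_1,\lambda_2}$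 is the system $L_{\lambda_1}F=L_{\lambda_2}F=0$. The differential operators are applied to $F$ modulo $p$ as follows: the function $(\lambda_1,\lambda_2)\mapsto F(\lambda_1,\lambda_2) \bmod p$ on $\mathbb{F}_p^2$ is identified with the unique polynomial in $\mathbb{F}_p[\lambda_1,\lambda_2]$ of degree less than $p$ in each variable that represents it, and the operators act on this polynomial formally (with $\tfrac14$ interpreted in $\mathbb{F}_p$). *)

(* Defs.v *)
From HB Require Import structures.
From mathcomp Require Import all_boot all_order all_algebra.
From mathcomp Require Import mpoly.

Set Implicit Arguments.
Unset Strict Implicit.
Unset Printing Implicit Defensive.

Import GRing.Theory.
Local Open Scope ring_scope.

Definition kummer_points (K : finFieldType) (l1 l2 : K) : {set K * K * K} :=
  [set q : K * K * K | let: (t, X, Y) := q in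
    Y ^+ 2 == X * (X - t * (t - 1) * (l2 * t - l1))
                * (X - t * (t - l1) * (l2 * t - 1))].

Definition kummer_count (p : nat) (l1 l2 : 'F_p) : nat :=
  #|kummer_points l1 l2|.

(* The variables 'X_i, i : 'I_2, stand for lambda_1 (i = ord0) and
   lambda_2 (i = ord_max). *)
Definition represents (p : nat) (f : 'F_p -> 'F_p -> 'F_p)
    (P : {mpoly 'F_p[2]}) : Prop :=
  (forall l1 l2 : 'F_p, P.@[tnth [tuple l1; l2]] = f l1 l2) /\
  (forall m, m \in msupp P -> forall i, (m i < p)%N).

(* The Gauss hypergeometric operator with alpha = beta = 1/2, gamma = 1, acting
   formally on polynomials in the variable z = 'X_i. *)
Definition hypergeom_op (K : fieldType) (n : nat) (i : 'I_n)
    (P : {mpoly K[n]}) : {mpoly K[n]} :=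
  'X_i * (1 - 'X_i) * P^`M(i)^`M(i) + (1 - 2%:R * 'X_i) * P^`M(i)
    - (4%:R^-1 : K) *: P.

Definition Picard_Fuchs (K : fieldType) (P : {mpoly K[2]}) : Prop :=
  hypergeom_op ord0 P = 0 /\ hypergeom_op ord_max P = 0.

(* Main.v *)
Require Import Defs.
From HB Require Import structures.
From mathcomp Require Import all_boot all_order all_algebra.
From mathcomp Require Import mpoly.
From mathcomp Require Import finfield ring zify.

Set Implicit Arguments.
Unset Strict Implicit.
Unset Printing Implicit Defensive.

Import GRing.Theory.
Local Open Scope ring_scope.

(** Let K be a finite field of odd order q = 2h + 1. The map x |-> x ^+ h is the
    quadratic character of K, with values in K itself, and c has 1 + c ^+ h
    square roots counted in K ([card_square_roots]). Since q = 0 in K, the number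
    of points of the Kummer surface is, in K, the sum over (t, X) of the h-th
    power of the cubic in X.

    This sum is a product. The Kummer surface is the quotient of E_1 x E_2 by
    the inversion, so it has the birational model
      y^2 = x_1 (x_1 - 1) (x_1 - l1) x_2 (x_2 - 1) (x_2 - l2),
    and the character sum of the right-hand side over (x_1, x_2) is
    a(l1) * a(l2), where a(l) ([legendre_sum]) is the character sum of
    x (x - 1) (x - l). The fibration of the theorem is t = x_1 / x_2: for fixed t
    this is a quartic in x_2 with the rational root 1, which x_2 = 1 + 1/u sends
    to infinity, and scaling and translating u gives the cubic of the theorem
    ([sum_fiber], [sum_kummer]). The points where these substitutions are not
    defined contribute sums of t ^+ h over all t, which vanish, and the identity
    of the two cubic character sums extends to the degenerate fibres.

    The power sums over K show that a(l) is, up to a sign that disappears in the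
    product, the Deuring polynomial H(l), the sum of C(h, k)^2 l^k
    ([legendre_sumE]). So F is represented by H(l1) H(l2), of degree at most
    h < q in each variable, and a polynomial of such degrees is determined by its
    values ([meval_reduced_inj]).

    Finally H is the reduction of the hypergeometric series F(1/2, 1/2; 1; z),
    because -h = 1/2 in K, and the operator annihilates it: the images of its
    monomials telescope ([hypergeom_op_deuring]). *)

(** * Power sums and square roots in a finite field *)

(** The translation x |-> x + 1 permutes K and adds #|K| to the sum of its
    elements. *)
Lemma natr_card_eq0 (K : finFieldType) : #|K|%:R = 0 :> K.
Proof.
apply: (addrI (\sum_(x : K) x)); rewrite addr0 [RHS](reindex_inj (addIr 1)) /=.
by rewrite big_split /= sumr_const.
Qed.

Lemma expf_card_pred (K : finFieldType) (x : K) :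
  x ^+ #|K|.-1 = (x != 0)%:R.
Proof.
have K1 : (1 < #|K|)%N by apply: finNzRing_gt1.
have [->|x0] := eqVneq x 0; first by rewrite expr0n; case: #|K| K1 => [|[]].
by apply: (mulfI x0); rewrite -exprS prednK ?expf_card ?mulr1 // ltnW.
Qed.

(** When q - 1 does not divide k, some nonzero y has y ^+ k != 1, and scaling by
    y permutes K and multiplies the sum by y ^+ k. *)
Lemma sum_expf (K : finFieldType) (k : nat) :
  \sum_(x : K) x ^+ k = - ((0 < k) && (#|K|.-1 %| k))%N%:R.
Proof.
have K1 : (1 < #|K|)%N by apply: finNzRing_gt1.
case: (posnP k) => [->|k0] /=.
  by under eq_bigr do rewrite expr0; rewrite sumr_const natr_card_eq0 oppr0.
have [kdvd|kndvd] := boolP (_ %| k)%N.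
  rewrite (bigD1 0) //= expr0n eqn0Ngt k0 add0r.
  rewrite (eq_bigr (fun=> 1)) => [|x x0]; last first.
    by have /dvdnP[m ->] := kdvd; rewrite mulnC exprM expf_card_pred x0 expr1n.
  rewrite sumr_const cardC1; apply/eqP; rewrite -subr_eq0 opprK.
  by rewrite -mulrSr prednK ?natr_card_eq0 // ltnW.
(* If every nonzero y had y ^+ r = 1, then 'X^r - 1 would have q - 1 > r roots. *)
rewrite oppr0; pose r := (k %% #|K|.-1)%N.
have r0 : (0 < r)%N by rewrite lt0n.
have rK : (r < #|K|.-1)%N by rewrite ltn_pmod // -ltnS prednK // ltnW.
have [y y0 yr] : exists2 y : K, y != 0 & y ^+ r != 1.
  apply/exists_inP; apply: contraLR rK => /exists_inPn allr; rewrite -leqNgt.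
  rewrite -(cardC1 (0 : K)) cardE; apply: max_unity_roots; rewrite ?enum_uniq //.
  apply/allP => y; rewrite mem_enum unity_rootE => y0.
  by have := allr y y0; rewrite negbK.
have yk : y ^+ k != 1.
  by rewrite (divn_eq k #|K|.-1) exprD mulnC exprM expf_card_pred y0 expr1n mul1r.
apply/eqP; have /eqP : \sum_(x : K) x ^+ k = y ^+ k * \sum_(x : K) x ^+ k.
  rewrite [LHS](reindex_inj (mulfI y0)) /= mulr_sumr.
  by under eq_bigr do rewrite exprMn.
rewrite -subr_eq0 -{1}[\sum_x _]mul1r -mulrBl mulf_eq0 subr_eq0 eq_sym.
by rewrite (negPf yk).
Qed.

Lemma card_half_gt0 (K : finFieldType) (h : nat) : #|K| = h.*2.+1 -> (0 < h)%N.
Proof. by move=> hK; move: (finNzRing_gt1 K); rewrite hK; case: h hK. Qed.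

(** Products of up to three h-th powers of affine functions have degree at most
    3h < 2(q - 1), so only the exponent q - 1 = 2h contributes. *)
Lemma sum_expf_half (K : finFieldType) (h k : nat) :
  #|K| = h.*2.+1 -> (k < h.*2.*2)%N ->
  \sum_(x : K) x ^+ k = - (k == h.*2)%:R.
Proof.
move=> hK kh; rewrite sum_expf hK /=; have h0 := card_half_gt0 hK.
congr (- _%:R); congr nat_of_bool; apply/andP/eqP => [[k0 /dvdnP[m Dk]]|->].
  by move: k0 kh; rewrite Dk; case: m {Dk} => [|[|m]]; lia.
by rewrite dvdnn double_gt0.
Qed.

Lemma dvdn_double_sub (h i : nat) : (0 < h)%N -> (i <= h.*2)%N ->
  ((0 < 2 * (h.*2 - i)) && (h.*2 %| 2 * (h.*2 - i)))%N
    = ((i == 0) + (i == h))%N :> nat.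
Proof.
move=> h0 ih; have [->|i0] := eqVneq i 0%N.
  by rewrite subn0 dvdn_mull //; case: h h0 ih.
have [->|inh] := eqVneq i h.
  by rewrite (_ : 2 * (h.*2 - h) = h.*2)%N ?dvdnn; lia.
case: (boolP (_ && _)) => // /andP[k0 /dvdnP[[|[|m]] Dm]]; nia.
Qed.

(** The geometric sum [G a] of the a^(q-1-i) c^i is the indicator of a <> c,
    because (a - c) * G a = a^q - c^q = a - c and G c = q c^(q-1) = 0. Hence the
    number of square roots of c is the sum of the 1 - G (y^2) over y, and the
    power sums leave only the terms i = 0 and i = h of G. *)
Lemma card_square_roots (K : finFieldType) (h : nat) (c : K) :
  #|K| = h.*2.+1 -> #|[set y : K | y ^+ 2 == c]|%:R = 1 + c ^+ h :> K.
Proof.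
move=> hK; have h0 := card_half_gt0 hK.
pose G (a : K) := \sum_(i < #|K|) a ^+ (#|K|.-1 - i) * c ^+ i.
have GE a : G a = (a != c)%:R.
  have [->|ac] := eqVneq a c.
    rewrite /G (eq_bigr (fun=> c ^+ #|K|.-1)) => [|i _].
      by rewrite sumr_const card_ord -[LHS]mulr_natr natr_card_eq0 mulr0.
    by rewrite -exprD subnK // -ltnS prednK // hK.
  apply: (mulfI (x := a - c)); first by rewrite subr_eq0.
  by rewrite -subrXX !expf_card mulr1.
rewrite -sum1_card natr_sum big_mkcond /=.
rewrite (eq_bigr (fun y : K => 1 - G (y ^+ 2))) => [|y _]; last first.
  by rewrite GE inE; case: eqP; rewrite /= ?subr0 ?subrr.
rewrite sumrB sumr_const natr_card_eq0 sub0r exchange_big /=.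
have delta k : (k < #|K|)%N ->
    \sum_(i < #|K|) (i == k :> nat)%:R * c ^+ i = c ^+ k.
  move=> kK; rewrite (bigD1 (Ordinal kK)) //= eqxx mul1r big1 ?addr0 // => i.
  by rewrite -val_eqE /= => /negPf->; rewrite mul0r.
rewrite (eq_bigr (fun i : 'I_#|K| => - ((i == 0 :> nat)%:R * c ^+ i
    + (i == h :> nat)%:R * c ^+ i))) => [|i _].
  by rewrite sumrN opprK big_split /= !delta ?expr0 // hK; lia.
rewrite -mulr_suml -mulrDl -mulNr -natrD; congr (_ * _).
under eq_bigr do rewrite -exprM.
have K1 : #|K|.-1 = h.*2 by rewrite hK.
rewrite sum_expf K1; congr (- _%:R).
by apply: dvdn_double_sub => //; rewrite -ltnS -[X in (_ < X)%N]hK.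
Qed.

(** * Character sums of low degree *)

(** The character is insensitive to a nonzero square factor; every change of
    variables below rests on this. *)
Lemma expr_half_sqrM (K : finFieldType) (h : nat) (u y : K) :
  #|K| = h.*2.+1 -> u != 0 -> (u ^+ 2 * y) ^+ h = y ^+ h.
Proof.
move=> hK u0; rewrite exprMn -exprM mul2n (_ : h.*2 = #|K|.-1); last by rewrite hK.
by rewrite expf_card_pred u0 mul1r.
Qed.

Lemma sum_affine (K : finFieldType) (h : nat) (a b : K) :
  #|K| = h.*2.+1 -> \sum_(u : K) (a * u + b) ^+ h = 0.
Proof.
move=> hK; under eq_bigr do rewrite exprDn.
rewrite exchange_big big1 // => i _.
under eq_bigr do rewrite exprMn mulrAC -mulrnAl.
have h0 := card_half_gt0 hK.
rewrite -mulr_sumr (sum_expf_half hK); last by lia.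
rewrite ltn_eqF ?oppr0 ?mulr0 // -addnn.
by rewrite (leq_ltn_trans (leq_subr i h)) // -[X in (X < _)%N]addn0 ltn_add2l.
Qed.

(** In characteristic p the value depends on the leading coefficient only, even
    for a degenerate or split quadratic. When a <> 0, moving the root -b/a to 0
    and inverting the variable turns the quadratic into an affine function with
    the term at 0 removed. *)
Lemma sum_quadratic (K : finFieldType) (h : nat) (a b c d : K) :
  #|K| = h.*2.+1 ->
  \sum_(u : K) ((a * u + b) * (c * u + d)) ^+ h = - (a * c) ^+ h.
Proof.
move=> hK; have h0 := card_half_gt0 hK.
have [->|a0] := eqVneq a 0.
  rewrite mul0r expr0n gtn_eqF // oppr0.
  under eq_bigr do rewrite mul0r add0r exprMn.
  by rewrite -mulr_sumr (sum_affine _ _ hK) mulr0.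
rewrite (reindex_inj (addrI (- (b / a)))) /= (reindex_inj (mulIf (invr_neq0 a0))) /=.
pose m := d - c * b / a.
rewrite (bigD1 0) //= (eq_bigr (fun u => (c / a + m * u^-1) ^+ h)) => [|u u0]; last first.
  rewrite -[RHS](expr_half_sqrM _ hK u0); congr (_ ^+ h).
  by rewrite /m; field; rewrite u0 a0.
rewrite [X in X ^+ h](_ : _ = 0) ?expr0n ?gtn_eqF ?add0r //; last first.
  by field.
have := sum_affine m (c / a) hK; rewrite (reindex_inj invr_inj) /= (bigD1 0) //=.
rewrite invr0 mulr0 add0r => /eqP; rewrite addrC addr_eq0 => /eqP.
under eq_bigr do rewrite addrC; move=> ->.
rewrite -(expr_half_sqrM (c / a) hK a0); congr (- _ ^+ h).
by field.
Qed.

Lemma sum_cubic_double_root (K : finFieldType) (h : nat) (m : K) :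
  #|K| = h.*2.+1 -> \sum_(X : K) (X ^+ 2 * (X + m)) ^+ h = - m ^+ h.
Proof.
move=> hK; have := sum_affine 1 m hK.
rewrite [X in X = _ -> _](bigD1 0) //= [X in _ -> X = _](bigD1 0) //=.
rewrite mulr0 add0r expr0n mul0r expr0n gtn_eqF ?(card_half_gt0 hK) // add0r.
move=> /eqP; rewrite addrC addr_eq0 => /eqP <-; apply: eq_bigr => X X0.
by rewrite (expr_half_sqrM _ hK X0) mul1r.
Qed.

(** The substitution X = c u with c = t a b d multiplies the right-hand cubic by
    c^2. When c = 0 it is not invertible, but the identity persists: the cubic in
    X has a double root at 0, and the cubic in u degenerates to a quadratic or to
    zero; both sums are then given by a leading coefficient. *)
Lemma sum_fiber (K : finFieldType) (h : nat) (t a b d : K) :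
  #|K| = h.*2.+1 ->
  \sum_(X : K) ((X + t * a * b) * (X + t ^+ 2 * b * d) * (X + t ^+ 2 * a * d)) ^+ h
  = \sum_(u : K) (t * (a * u + t) * (b * u + t) * (d * u + 1)) ^+ h.
Proof.
move=> hK; have h0 := card_half_gt0 hK.
have double_root m f : (forall X, f X = X ^+ 2 * (X + m)) ->
    \sum_(X : K) f X ^+ h = - m ^+ h.
  by move=> fE; under eq_bigr do rewrite fE; apply: sum_cubic_double_root.
have quadratic e a' b' c' d' f :
    (forall u, f u = (a' * u + b') * (c' * u + d')) -> e = a' * c' ->
    \sum_(u : K) f u ^+ h = - e ^+ h.
  by move=> fE ->; under eq_bigr do rewrite fE; apply: sum_quadratic.
have [->|t0] := eqVneq t 0.
  rewrite [RHS]big1 => [|u _]; last by rewrite !mul0r expr0n gtn_eqF.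
  rewrite (double_root 0) => [|X]; last by ring.
  by rewrite expr0n gtn_eqF // oppr0.
have [->|a0] := eqVneq a 0.
  rewrite (double_root (t ^+ 2 * b * d)) => [|X]; last by ring.
  by rewrite (quadratic (t ^+ 2 * b * d) (t ^+ 2 * b) (t ^+ 3) d 1) // => *; ring.
have [->|b0] := eqVneq b 0.
  rewrite (double_root (t ^+ 2 * a * d)) => [|X]; last by ring.
  by rewrite (quadratic (t ^+ 2 * a * d) (t ^+ 2 * a) (t ^+ 3) d 1) // => *; ring.
have [->|d0] := eqVneq d 0.
  rewrite (double_root (t * a * b)) => [|X]; last by ring.
  by rewrite (quadratic (t * a * b) (t * a) (t ^+ 2) b t) // => *; ring.
have c0 : t * a * b * d != 0 by rewrite !mulf_neq0.
rewrite (reindex_inj (mulfI c0)) /=; apply: eq_bigr => u _.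
rewrite -[RHS](expr_half_sqrM _ hK c0); congr (_ ^+ h); ring.
Qed.

(** * The Kummer surface as a product *)

(** For #|K| = 2h + 1 this is, in K, minus the trace of Frobenius of the curve
    y^2 = x (x - 1) (x - l). *)
Definition legendre_sum (K : finFieldType) (h : nat) (l : K) : K :=
  \sum_(x : K) (x * (x - 1) * (x - l)) ^+ h.

(** The substitutions x_1 = t x_2 and x_2 = 1 + 1/u in the product, followed by
    the fibrewise identity [sum_fiber]. *)
Lemma sum_kummer (K : finFieldType) (h : nat) (l1 l2 : K) :
  #|K| = h.*2.+1 ->
  \sum_(t : K) \sum_(X : K) (X * (X - t * (t - 1) * (l2 * t - l1))
                * (X - t * (t - l1) * (l2 * t - 1))) ^+ h
  = legendre_sum h l1 * legendre_sum h l2.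
Proof.
move=> hK; have h0 := card_half_gt0 hK.
have sum_t : \sum_(t : K) t ^+ h = 0.
  by rewrite -[RHS](sum_affine 1 0 hK); under [RHS]eq_bigr do rewrite mul1r addr0.
pose f t x := (t * (t * x - 1) * (t * x - l1) * ((x - 1) * (x - l2))) ^+ h.
(* f t x is the character sum term of the product at x_1 = t x and x_2 = x, up
   to the square x^2; at x = 0 the sum over t vanishes. *)
transitivity (\sum_t \sum_x f t x); last first.
  rewrite exchange_big /= /legendre_sum mulr_sumr; apply: eq_bigr => x _.
  have [->|x0] := eqVneq x 0.
    rewrite !mul0r expr0n gtn_eqF // mulr0.
    rewrite (eq_bigr (fun t => t ^+ h * (l1 * l2) ^+ h)).
      by rewrite -mulr_suml sum_t mul0r.
    by move=> t _; rewrite -exprMn; congr (_ ^+ h); ring.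
  rewrite mulr_suml [RHS](reindex_inj (mulIf x0)) /=; apply: eq_bigr => t _.
  by rewrite -exprMn -[LHS](expr_half_sqrM _ hK x0); congr (_ ^+ h); ring.
(* After x = 1 + 1/u the value u = 0 is missing; its term is t ^+ h up to a
   square. *)
transitivity (\sum_t \sum_x f t x + \sum_(t : K) t ^+ h); last first.
  by rewrite sum_t addr0.
rewrite -big_split; apply: eq_bigr => t _ /=.
have fib := sum_fiber t (t - 1) (t - l1) (1 - l2) hK.
transitivity (\sum_(u : K) (t * ((t - 1) * u + t) * ((t - l1) * u + t) *
   ((1 - l2) * u + 1)) ^+ h).
  rewrite -fib [LHS](reindex_inj (addIr (t * (t - 1) * (t - l1)))) /=.
  by apply: eq_bigr => X _; congr (_ ^+ h); ring.
(* With 0^-1 = 0 the map u |-> 1 + u^-1 is a bijection of K; it sends 0 to the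
   root x = 1 of f t. *)
rewrite [in RHS](reindex_inj (addrI 1)) [in RHS](reindex_inj invr_inj) /=.
rewrite (bigD1 0) //= addrC [in RHS](bigD1 0) //=; congr (_ + _).
  rewrite invr0 addr0 /f subrr mul0r mulr0 expr0n gtn_eqF // add0r.
  apply: eq_bigr => u u0.
  rewrite -[LHS](expr_half_sqrM _ hK (_ : u ^- 2 != 0)) ?invr_neq0 ?expf_neq0 //.
  by congr (_ ^+ h); field.
rewrite !mulr0 !add0r mulr1.
have [->|t0] := eqVneq t 0; first by rewrite !mulr0.
by rewrite -[RHS](expr_half_sqrM _ hK t0); congr (_ ^+ h); ring.
Qed.

Lemma kummer_count_sum (K : finFieldType) (h : nat) (l1 l2 : K) :
  #|K| = h.*2.+1 ->
  #|kummer_points l1 l2|%:R = legendre_sum h l1 * legendre_sum h l2.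
Proof.
move=> hK; rewrite -(sum_kummer _ _ hK).
pose f t X : K := X * (X - t * (t - 1) * (l2 * t - l1))
                * (X - t * (t - l1) * (l2 * t - 1)).
transitivity (\sum_(q : K * K) (#|[set Y : K | Y ^+ 2 == f q.1 q.2]|%:R : K)).
  rewrite -natr_sum; congr (_%:R).
  rewrite -sum1_card big_mkcond /=.
  rewrite (eq_bigr (fun q : K * K * K => q.2 ^+ 2 == f q.1.1 q.1.2 : nat)).
    rewrite -(pair_bigA _ (fun q Y => Y ^+ 2 == f q.1 q.2 : nat)) /=.
    apply: eq_bigr => q _; rewrite -sum1_card [RHS]big_mkcond /=.
    by apply: eq_bigr => Y _; rewrite inE; case: eqP.
  by move=> [[t X] Y] _; rewrite inE /f /=; case: eqP.
under eq_bigr do rewrite (card_square_roots _ hK).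
rewrite big_split /= sumr_const card_prod natrM natr_card_eq0 mul0r add0r.
by rewrite -(pair_bigA _ (fun t X => f t X ^+ h)).
Qed.

(** Expanding both binomials gives the monomials x^(3h - i - k), and the power sum
    selects i = h - k. *)
Lemma legendre_sumE (K : finFieldType) (h : nat) (l : K) :
  #|K| = h.*2.+1 ->
  legendre_sum h l = - (-1) ^+ h * \sum_(k < h.+1) 'C(h, k)%:R ^+ 2 * l ^+ k.
Proof.
move=> hK; have h0 := card_half_gt0 hK; rewrite /legendre_sum.
pose c (z : K) (i : nat) : K := (-1) ^+ i * z ^+ i * 'C(h, i)%:R.
have binom z (x : K) : (x - z) ^+ h = \sum_(i < h.+1) c z i * x ^+ (h - i).
  by rewrite exprBn; apply: eq_bigr => i _; rewrite -mulr_natr /c; ring.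
have expand (x : K) : (x * (x - 1) * (x - l)) ^+ h =
    \sum_(k < h.+1) \sum_(i < h.+1) c l k * c 1 i * x ^+ (h + (h - i) + (h - k)).
  rewrite !exprMn !binom mulr_sumr; apply: eq_bigr => k _.
  rewrite mulr_sumr mulr_suml; apply: eq_bigr => i _.
  by rewrite !exprD; ring.
under eq_bigr do rewrite expand.
rewrite exchange_big mulr_sumr /=; apply: eq_bigr => k _.
have kh : (k <= h)%N by rewrite -ltnS.
rewrite exchange_big /= (bigD1 (rev_ord k)) //= [X in _ + X]big1 ?addr0 => [|i ik].
    rewrite -mulr_sumr (sum_expf_half hK); last by lia.
  rewrite subSS subKn // (_ : (h + k + (h - k) == h.*2)%N); last by lia.
  have <- : (-1) ^+ k * (-1) ^+ (h - k) = (-1) ^+ h :> K.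
    by rewrite -exprD subnKC.
  by rewrite /c bin_sub // expr1n /=; ring.
rewrite -mulr_sumr (sum_expf_half hK); last by lia.
rewrite (_ : (_ == _) = false) ?oppr0 ?mulr0 //.
by move: ik; rewrite -val_eqE /= subSS; have := ltn_ord i; lia.
Qed.

(** * The hypergeometric equation of the Deuring polynomial *)

(** The Deuring polynomial, or Hasse invariant of the Legendre family, in the
    variable 'X_i. *)
Definition deuring (K : fieldType) (n h : nat) (i : 'I_n) : {mpoly K[n]} :=
  \sum_(k < h.+1) 'C(h, k)%:R ^+ 2 *: 'X_i ^+ k.

Lemma mderivXn (K : fieldType) (n : nat) (i : 'I_n) (k : nat) :
  ('X_i ^+ k : {mpoly K[n]})^`M(i) = k%:R *: 'X_i ^+ k.-1.
Proof.
rewrite mpolyXn mderivX mulmnE mnm1E eqxx mul1n mpolyXn; congr (_ *: 'X_[_]).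
by case: k => [|k]; apply/mnmP => j; rewrite mnmBE !mulmnE mnm1E; case: eqP; lia.
Qed.

Lemma mderivXn_neq (K : fieldType) (n : nat) (i j : 'I_n) (k : nat) :
  j != i -> ('X_i ^+ k : {mpoly K[n]})^`M(j) = 0.
Proof.
move=> ji; rewrite mpolyXn mderivX mulmnE mnm1E eq_sym (negPf ji) mul0n.
by rewrite scale0r.
Qed.

Lemma mderiv_deuring_neq (K : fieldType) (n h : nat) (i j : 'I_n) :
  j != i -> (deuring K h i)^`M(j) = 0.
Proof.
move=> ji; rewrite /deuring raddf_sum big1 // => k _.
by rewrite /= mderivZ mderivXn_neq // scaler0.
Qed.

Lemma hypergeom_opD (K : fieldType) (n : nat) (i : 'I_n) :
  {morph @hypergeom_op K n i : P Q / P + Q}.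
Proof. by move=> P Q; rewrite /hypergeom_op !mderivD scalerDr; ring. Qed.

(** The operator is linear over the polynomials in the other variables. *)
Lemma hypergeom_opMl (K : fieldType) (n : nat) (i : 'I_n) (Q P : {mpoly K[n]}) :
  Q^`M(i) = 0 -> hypergeom_op i (Q * P) = Q * hypergeom_op i P.
Proof.
move=> Q0; rewrite /hypergeom_op !(mderivM, Q0, mul0r, add0r) -!mul_mpolyC; ring.
Qed.

(** Wherever 2 is invertible, L(z^k) = k^2 z^(k-1) - (k + 1/2)^2 z^k, and
    here 1/2 = - h. *)
Lemma hypergeom_opXn (K : fieldType) (h n : nat) (i : 'I_n) (k : nat) :
  (h.*2.+1)%:R = 0 :> K ->
  hypergeom_op i ('X_i ^+ k) =
  k%:R ^+ 2 *: 'X_i ^+ k.-1 - (h%:R - k%:R) ^+ 2 *: 'X_i ^+ k :> {mpoly K[n]}.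
Proof.
move=> h2.
have half4 : 4%:R^-1 = h%:R ^+ 2 :> K.
  have h21 : h%:R * 2%:R = -1 :> K.
    by apply/eqP; rewrite -addr_eq0 -natrM -mulrSr muln2 h2.
  have h4 : h%:R ^+ 2 * 4%:R = 1 :> K.
    by rewrite -[4%:R]/((2 * 2)%:R) natrM -expr2 -exprMn h21 sqrrN expr1n.
  have n4 : 4%:R != 0 :> K.
    by apply: contra_eq_neq h4 => ->; rewrite mulr0 eq_sym oner_eq0.
  by apply: (mulIf n4); rewrite mulVf.
have sqrBk : (h%:R - k%:R) ^+ 2 = h%:R ^+ 2 + k%:R ^+ 2 + k%:R :> K.
  have h1 : h%:R + h%:R = -1 :> K.
    by apply/eqP; rewrite -addr_eq0 -natrD -mulrSr addnn h2.
  rewrite [LHS](_ : _ = h%:R ^+ 2 + k%:R ^+ 2 - (h%:R + h%:R) * k%:R); last by ring.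
  by rewrite h1; ring.
rewrite /hypergeom_op half4 sqrBk !(mderivXn, mderivZ).
rewrite -!mul_mpolyC !(rmorphD, rmorphXn, rmorph_nat) /=.
by case: k {sqrBk} => [|[|k]] /=; rewrite ?mulrSr ?exprS; ring.
Qed.

(** Since (k+1) C(h, k+1) = (h-k) C(h, k), the k-th term of the sum is sent to
    e k - e (k+1), where e k = (k C(h, k))^2 z^(k-1) vanishes at k = 0 and at
    k = h + 1. *)
Lemma hypergeom_op_deuring (K : fieldType) (h n : nat) (i : 'I_n) :
  (h.*2.+1)%:R = 0 :> K -> hypergeom_op i (deuring K h i) = 0.
Proof.
move=> h2; pose e k : {mpoly K[n]} := (k * 'C(h, k))%:R ^+ 2 *: 'X_i ^+ k.-1.
rewrite /deuring (big_morph _ (hypergeom_opD i) (_ : _ = 0)); last first.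
  by rewrite /hypergeom_op !mderiv0 !mulr0 scaler0 addr0 subrr.
transitivity (- \sum_(0 <= k < h.+1) (e k.+1 - e k)); last first.
  rewrite telescope_sumr // /e bin_small // mul0n muln0 !expr0n !scale0r.
  by rewrite subrr oppr0.
rewrite big_mkord -sumrN; apply: eq_bigr => k _; rewrite opprB.
rewrite -mul_mpolyC hypergeom_opMl ?mderivC // mul_mpolyC.
rewrite (hypergeom_opXn _ _ h2) scalerBr !scalerA /e mul_bin_left.
have kh : (k <= h)%N by rewrite -ltnS.
by rewrite !natrM natrB //=; congr (_ *: _ - _ *: _); ring.
Qed.

Lemma Picard_Fuchs_deuring (K : fieldType) (h : nat) :
  (h.*2.+1)%:R = 0 :> K ->
  Picard_Fuchs (deuring K h ord0 * deuring K h ord_max : {mpoly K[2]}).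
Proof.
move=> h2; split.
  by rewrite mulrC hypergeom_opMl ?mderiv_deuring_neq // hypergeom_op_deuring ?mulr0.
by rewrite hypergeom_opMl ?mderiv_deuring_neq // hypergeom_op_deuring ?mulr0.
Qed.

Lemma meval_deuring (K : fieldType) (n h : nat) (i : 'I_n) (v : 'I_n -> K) :
  (deuring K h i).@[v] = \sum_(k < h.+1) 'C(h, k)%:R ^+ 2 * v i ^+ k.
Proof.
rewrite /deuring raddf_sum; apply: eq_bigr => k _ /=.
by rewrite mevalZ rmorphXn /= mevalXU.
Qed.

Lemma msupp_deuringM (K : fieldType) (h : nat) (m : 'X_{1..2}) (i : 'I_2) :
  m \in msupp (deuring K h ord0 * deuring K h ord_max : {mpoly K[2]}) ->
  (m i <= h)%N.
Proof.
apply: contraLR; rewrite -ltnNge => mi; rewrite mcoeff_msupp negbK; apply/eqP.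
rewrite /deuring mulr_suml raddf_sum big1 // => j _ /=.
rewrite mulr_sumr raddf_sum big1 // => k _ /=.
rewrite -scalerAl -scalerAr !mcoeffZ !mpolyXn -mpolyXD mcoeffX.
rewrite [_ == m](_ : _ = false) ?mulr0 //; apply: contraTF mi => /eqP <-.
rewrite -leqNgt mnmDE !mulmnE !mnm1E.
have := ltn_ord j; have := ltn_ord k.
by case: i => -[|[|//]] i2 /=; rewrite !(mul0n, mul1n, addn0, add0n) !ltnS.
Qed.

(** * Polynomials of degree less than q in each variable *)

(** For summation over K, the functions x^(q-1-k) are almost dual to the powers
    x^j with j < q. Only x^(q-1) fails, as it pairs with both x^0 and x^(q-1);
    subtracting 1 when k = 0 corrects this. *)
Lemma sum_dual_expf (K : finFieldType) (k j : nat) :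
  (k < #|K|)%N -> (j < #|K|)%N ->
  \sum_(x : K) (x ^+ (#|K|.-1 - k) - (k == 0)%:R) * x ^+ j = - (k == j)%:R.
Proof.
have [N N0 KE] : exists2 N, (0 < N)%N & #|K| = N.+1.
  by exists #|K|.-1; have := finNzRing_gt1 K; case: #|K| => [|[]].
rewrite KE /= !ltnS => kN jN; under eq_bigr do rewrite mulrBl -exprD.
rewrite sumrB -mulr_sumr !sum_expf KE /= {KE}.
have [->|k0] := posnP k.
  rewrite subn0 addn_gt0 N0 dvdn_addr // mul1r opprK addrC.
  have [->|j0] := posnP j; first by rewrite dvdn0 sub0r.
  by rewrite subrr (ltn_eqF j0) oppr0.
rewrite mulr0n mul0r subr0; congr (- _%:R); congr nat_of_bool.
apply/andP/eqP => [[ekj /dvdnP[[|[|m]] Dm]]|<-]; try by nia.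
by rewrite subnK ?dvdnn.
Qed.

(** Coefficients are recovered from values by pairing with products of the
    one-variable dual functions. *)
Lemma sum_meval_dual (K : finFieldType) (n : nat) (P : {mpoly K[n]}) (m : 'X_{1..n}) :
  (forall m', m' \in msupp P -> forall i, (m' i < #|K|)%N) ->
  (forall i, (m i < #|K|)%N) ->
  \sum_(v : {ffun 'I_n -> K})
     P.@[v] * \prod_i (v i ^+ (#|K|.-1 - m i) - (m i == 0)%:R)
  = (-1) ^+ n * P@_m.
Proof.
move=> Pdeg mdeg.
have monom m' : m' \in msupp P ->
    \sum_(v : {ffun 'I_n -> K}) (\prod_i v i ^+ m' i)
       * \prod_i (v i ^+ (#|K|.-1 - m i) - (m i == 0)%:R)
    = (-1) ^+ n * (m' == m)%:R.
  move=> /Pdeg m'deg; under eq_bigr do rewrite -big_split /=.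
  rewrite -(bigA_distr_bigA
    (fun i (x : K) => x ^+ m' i * (x ^+ (#|K|.-1 - m i) - (m i == 0)%:R))) /=.
  under eq_bigr => i _.
    under eq_bigr do rewrite mulrC.
    rewrite sum_dual_expf // -mulN1r.
  over.
  rewrite big_split prodr_const card_ord; congr (_ * _).
  have [->|m'm] := eqVneq m' m; first by rewrite big1 // => i _; rewrite eqxx.
  have [i mi] : exists i, m i != m' i.
    apply/existsP; apply: contraR m'm => /existsPn mm'.
    by apply/eqP/mnmP => i; apply/esym/eqP; rewrite -[_ == _]negbK mm'.
  by rewrite (bigD1 i) //= (negPf mi) mul0r.
under eq_bigr do rewrite mevalE mulr_suml.
rewrite exchange_big /= (eq_big_seq (fun m' => (-1) ^+ n * (P@_m' * (m' == m)%:R))).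
  rewrite -mulr_sumr; congr (_ * _).
  have [mP|mP] := boolP (m \in msupp P).
    rewrite (bigD1_seq m) //= ?msupp_uniq // eqxx mulr1 big1 ?addr0 // => m' /negPf->.
    by rewrite mulr0.
  rewrite big1_seq ?(memN_msupp_eq0 mP) // => m' /= m'P.
  by rewrite (negPf (memPn mP _ m'P)) mulr0.
move=> m' m'P; under eq_bigr do rewrite -mulrA.
by rewrite -mulr_sumr monom // mulrCA.
Qed.

Lemma meval_reduced_inj (K : finFieldType) (n : nat) (P Q : {mpoly K[n]}) :
  (forall m, m \in msupp P -> forall i, (m i < #|K|)%N) ->
  (forall m, m \in msupp Q -> forall i, (m i < #|K|)%N) ->
  (forall v : 'I_n -> K, P.@[v] = Q.@[v]) -> P = Q.
Proof.
move=> Pdeg Qdeg PQ; apply/mpolyP => m.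
have [/forallP mdeg|] := boolP [forall i, m i < #|K|]%N.
  apply: (mulfI (_ : (-1) ^+ n != 0 :> K)); first by rewrite signr_eq0.
  by rewrite -!sum_meval_dual //; under eq_bigr do rewrite PQ.
move=> /forallPn[i mi]; rewrite !memN_msupp_eq0 //.
  by apply: contra mi => /Qdeg.
by apply: contra mi => /Pdeg.
Qed.

(** * The counting function and the Picard-Fuchs system *)

(** Both signs in [legendre_sumE] are the same, so they cancel. *)
Lemma meval_kummer (K : finFieldType) (h : nat) (l1 l2 : K) :
  #|K| = h.*2.+1 ->
  (deuring K h ord0 * deuring K h ord_max).@[tnth [tuple l1; l2]]
  = #|kummer_points l1 l2|%:R.
Proof.
move=> hK; rewrite (kummer_count_sum _ _ hK) !(legendre_sumE _ hK).
rewrite mevalM !meval_deuring !(tnth_nth 0) /=.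
by rewrite mulrACA mulrNN -expr2 sqrr_sign mul1r.
Qed.

Theorem theorem1p1 (p : nat) (p_prime : prime p) (p_odd : odd p) :
  exists P : {mpoly 'F_p[2]},
    unique (represents (fun l1 l2 : 'F_p => (kummer_count l1 l2)%:R)) P /\
    Picard_Fuchs P.
Proof.
have [h ph] : exists h, p = h.*2.+1.
  by exists p./2; rewrite -[LHS]odd_double_half p_odd.
have hK : #|'F_p| = h.*2.+1 by rewrite card_Fp.
pose P : {mpoly 'F_p[2]} := deuring _ h ord0 * deuring _ h ord_max.
exists P; split; last first.
  by apply: Picard_Fuchs_deuring; rewrite -hK natr_card_eq0.
have deg m : m \in msupp P -> forall i, (m i < p)%N.
  by move=> mP i; rewrite ph ltnS (leq_trans (msupp_deuringM i mP)) // -addnn leq_addr.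
have eval (l1 l2 : 'F_p) :
    P.@[tnth [tuple l1; l2]] = (kummer_count l1 l2)%:R.
  exact: meval_kummer.
split=> [|Q [Qeval Qdeg]]; first by split.
apply: meval_reduced_inj; rewrite ?card_Fp // => v.
have vE : v =1 tnth [tuple v ord0; v ord_max].
  by case=> -[|[|//]] i2; rewrite (tnth_nth 0) /=; congr v; apply: val_inj.
by rewrite !(meval_eq _ vE) eval Qeval.
Qed.
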